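(* There exist absolute constants $C_1, C_2, c>0$ and $\epsilon\in(0,1/4)$ such that for every integer $d\ge1$ there is $p_0=p_0(d)$ for which the following holds for all integers $p\ge p_0$. Put $\delta=\lceil C_1\log p\rceil$ and $m=\lceil C_2\sqrt{dp}\,\log p\rceil$. Let $X\in\mathbb{R}^{p\times p}$ be a fixed $d$-distributed sparse matrix, let $N\in\mathbb{R}^{p\times p}$ be a fixed matrix, and let $\hat X=X+N$. Let $A,B$ be $m\times p$ matrices such that either (a) $A$ and $B$ are drawn independently from the $\delta$-random bipartite ensemble, or (b) $A$ is drawn from the $\delta$-random bipartite ensemble and $B=A$. Then with probability exceeding $1-p^{-c}$ (over the draw of $A,B$), any optimal solution $X^\ast$ of $$\text{minimize}_{\tilde X\in\mathbb{R}^{p\times p}}\ \|\tilde X\|_1\quad\text{subject to}\quad A\tilde XB^T=A\hat XB^T$$ satisfies $$\|X^\ast-X\|_1\le\frac{5-12\epsilon}{1-4\epsilon}\,\|N\|_1 .$$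
   Context: Notation: $[p]=\{1,\dots,p\}$; for a matrix $M$, $\|M\|_1=\sum_{i,j}|M_{ij}|$ (entrywise $\ell_1$ norm). Distributed sparsity: a set $\Omega\subset[p]\times[p]$ is $d$-distributed if (1) $(i,i)\in\Omega$ for all $i\in[p]$, and (2) for every $k\in[p]$, each of the sets $\{(i,j)\in\Omega: i=k\}$ and $\{(i,j)\in\Omega: j=k\}$ has at most $d$ elements. A matrix $X\in\mathbb{R}^{p\times p}$ is $d$-distributed sparse if $\{(i,j): X_{ij}\ne 0\}\subset\Omega$ for some $d$-distributed set $\Omega$. $\delta$-random bipartite ensemble (of $m\times p$ matrices): for each left vertex $i\in[p]$, choose $\delta$ right vertices $j_1(i),\dots,j_\delta(i)\in[m]$ independently and uniformly at random with replacement, independently over different $i$; this gives a random $\delta$-left regular bipartite (multi)graph with left set $[p]$ and right set $[m]$. The matrix $A\in\mathbb{R}^{m\times p}$ has entries $A_{ji}=\#\{k\in[\delta]: j_k(i)=j\}$ (the number of edges joining left vertex $i$ to right vertex $j$). *)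

(* Defs.v *)
From mathcomp Require Import all_boot all_order all_algebra.
From mathcomp Require Import boolp reals exp.

Set Implicit Arguments.
Unset Strict Implicit.
Unset Printing Implicit Defensive.

Import Order.TTheory GRing.Theory Num.Theory.
Local Open Scope ring_scope.

(* MathComp-Analysis norms matrices by the largest entry, hence this definition. *)
Definition l1norm (R : realType) (m n : nat) (M : 'M[R]_(m, n)) : R :=
  \sum_(i < m) \sum_(j < n) `|M i j|.

Definition distributed (p d : nat) (Omega : {set 'I_p * 'I_p}) : Prop :=
  (forall i : 'I_p, (i, i) \in Omega) /\
  (forall k : 'I_p,
     (#|[set x in Omega | x.1 == k]| <= d)%N /\
     (#|[set x in Omega | x.2 == k]| <= d)%N).

Definition distributed_sparse (R : realType) (p d : nat) (X : 'M[R]_p) : Prop :=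
  exists2 Omega : {set 'I_p * 'I_p},
    distributed d Omega & [set x | X x.1 x.2 != 0] \subset Omega.

(* w is the mass function of a law on the finite type T. *)
Definition prob (R : realType) (T : finType) (w : T -> R) (E : T -> Prop) : R :=
  \sum_(x : T | `[< E x >]) w x.

Definition uniform_law (R : realType) (T : finType) (x : T) : R := #|T|%:R^-1.

(* Law of a pair of independent draws. *)
Definition prod_law (R : realType) (T U : finType) (w : T -> R) (v : U -> R)
  (x : T * U) : R := w x.1 * v x.2.

(* g i k is the right end of the k-th edge leaving the left vertex i, so that
   parallel edges are allowed. *)
Definition bigraph (p delta m : nat) : finType :=
  {ffun 'I_p -> {ffun 'I_delta -> 'I_m}}.

(* The p * delta right ends are independent and uniform on 'I_m. *)
Definition ensemble_law (R : realType) (p delta m : nat)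
  (g : bigraph p delta m) : R :=
  \prod_(i < p) \prod_(k < delta) uniform_law R (g i k).

Definition biadjacency (R : realType) (p delta m : nat)
  (g : bigraph p delta m) : 'M[R]_(m, p) :=
  \matrix_(j < m, i < p) #|[set k : 'I_delta | g i k == j]|%:R.

Definition l1_optimal (R : realType) (m p : nat) (A B : 'M[R]_(m, p))
  (Xhat Xs : 'M[R]_p) : Prop :=
  A *m Xs *m B^T = A *m Xhat *m B^T /\
  (forall Y : 'M[R]_p,
     A *m Y *m B^T = A *m Xhat *m B^T -> l1norm Xs <= l1norm Y).

(* Main.v *)
Require Import Defs.
From mathcomp Require Import all_boot all_order all_algebra.
From mathcomp Require Import boolp reals sequences exp.
From mathcomp Require Import zify ring lra.

Set Implicit Arguments.
Unset Strict Implicit.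
Unset Printing Implicit Defensive.

Import Order.TTheory GRing.Theory Num.Theory.

(* Write the columns of [A] and [B] as [a_i] and [b_j], let [Om] be a distributed
   set supporting [X], and put
     K (i,j) (i',j') = \sum_(r != s) a_i(r) b_j(s) a_i'(r) b_j'(s).
   If [A W B^T = 0] then [\sum_e W_e K(e,f) = 0] for every [f].  When [K(f,f)] is
   about [delta^2] and, for every [e], the sum of [K(e,f)] over the other [f] in
   [Om] is at most a third of that, summing over [f] in [Om] shows that [W] has at
   most a third of its l1 mass on [Om]; comparing the norms of [X + N] and
   [X + N + W] then gives the constant 7 = (5 - 12/8) / (1 - 4/8).

   Both cases are instances of one random graph, with left vertices ['I_p + 'I_p]
   in case (a) and ['I_p] in case (b).  Its right ends being uniform, [k] equations
   between right ends whose left-hand sides are distinct and do not occur on the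
   right have probability [m^-k].  A union bound over such systems shows that two
   left vertices share few right ends.  For a fixed [e], the pairs [f] in [Om] with
   no vertex in common with [e] are split into [4 d] classes of pairwise disjoint
   pairs (greedy colouring); in each class at most of order [delta^2 / d] pairs
   overlap [e], except with probability exponentially small in [delta^2 / d]. *)

(** * Counting solutions of systems of equations *)

(** Overwriting [g] by a constant on the left-hand sides [x j] loses nothing: every [y j] keeps its
    value, and the equation at [j] then recovers [g (x j)]. So [#|D|] values are forced. *)
Lemma card_eq_system (U V J : finType) (D : {set J}) (x y : J -> U) :
  {in D &, injective x} -> (forall i j, i \in D -> j \in D -> y i != x j) ->
  (#|[set g : {ffun U -> V} | [forall j in D, g (x j) == g (y j)]]| *
     #|V| ^ #|D| <= #|V| ^ #|U|)%N.
Proof.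
move=> injx yx; set E := [set g | _].
have [v0 _|v0] := pickP (fun _ : V => true); last first.
  have V0 : #|V| = 0 by apply: eq_card0.
  have [->|[j jD]] := set_0Vmem D.
    rewrite cards0 expn0 muln1 -[X in (_ <= X)%N]card_ffun; exact: max_card.
  have D0 : (0 < #|D|)%N by apply/card_gt0P; exists j.
  by rewrite V0 (exp0n D0) muln0.
pose W := [set x j | j in D].
pose h (g : {ffun U -> V}) : {ffun U -> V} :=
  [ffun c => if c \in W then v0 else g c].
have injh : {in E &, injective h}.
  move=> g1 g2; rewrite !inE => /forall_inP e1 /forall_inP e2 /ffunP eh.
  have out c : c \notin W -> g1 c = g2 c.
    by move=> cW; move: (eh c); rewrite !ffunE (negbTE cW).
  apply/ffunP => c; have [/imsetP[j jD ->]|/out//] := boolP (c \in W).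
  rewrite (eqP (e1 _ jD)) (eqP (e2 _ jD)); apply: out.
  by apply/imsetP => -[k kD eyx]; move: (yx _ _ jD kD); rewrite eyx eqxx.
have sub : h @: E \subset pffun_on v0 (mem (~: W)) predT.
  apply/subsetP => _ /imsetP[g _ ->]; apply/pffun_onP; split=> [|//].
  apply/subsetP => c; rewrite !inE ffunE.
  by case: ifP => //; rewrite eqxx.
have := subset_leq_card sub.
rewrite card_in_imset // card_pffun_on => /leq_mul leE.
apply: leq_trans (leE _ _ (leqnn _)) _.
by rewrite -(card_in_imset injx) -/W -expnD addnC cardsC leqnn.
Qed.

Lemma leq_card_bigcup (G I : finType) (P : pred I) (B : I -> {set G}) :
  (#|\bigcup_(i in P) B i| <= \sum_(i in P) #|B i|)%N.
Proof.
elim/big_rec2: _ => [|i n H _ IH]; first by rewrite cards0.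
by apply: leq_trans (leq_card_setU _ _) _; rewrite leq_add2l.
Qed.

(** A union bound with the denominator [M] kept on the left, so that all counting stays in [nat]. *)
Lemma card_exists_mul (G I : finType) (P : I -> pred G) (n M B : nat) :
  (#|I| <= n)%N -> (forall i, #|[set g | P i g]| * M <= B)%N ->
  (#|[set g | [exists i, P i g]]| * M <= n * B)%N.
Proof.
move=> In PB; have -> : [set g | [exists i, P i g]] =
    \bigcup_(i in predT) [set g | P i g].
  apply/setP => g; rewrite inE; apply/existsP/bigcupP => -[i].
    by exists i; rewrite ?inE.
  by rewrite inE; exists i.
apply: (@leq_trans ((\sum_(i in predT) #|[set g | P i g]|) * M)).
  by rewrite leq_mul2r leq_card_bigcup orbT.
apply: (@leq_trans (#|I| * B)); last by rewrite leq_mul2r In orbT.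
by rewrite big_distrl -sum_nat_const; apply: leq_sum => i _; exact: PB.
Qed.

(** If at least [L] indices have a witness, some [L]-subset [T] of [C] and some choice of witnesses
    on [T] make all its events hold; the union bound runs over these choices. *)
Lemma card_many_events (G S Y : finType) (y0 : Y) (ev : S -> Y -> pred G)
    (C : {set S}) (L M : nat) :
  (forall (T : {set S}) (f : S -> Y), T \subset C -> #|T| = L ->
     #|[set g | [forall t in T, ev t (f t) g]]| * M <= #|G|)%N ->
  (#|[set g | L <= #|[set t in C | [exists y, ev t y g]]|]| * M
     <= 'C(#|C|, L) * #|Y| ^ L * #|G|)%N.
Proof.
move=> evM; set E := [set g | _].
pose X := [set T : {set S} | T \subset C & #|T| == L].
(* Fixing the value [y0] off [T] leaves exactly [#|Y| ^ L] choices of witnesses for each [T]. *)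
pose F (T : {set S}) := [set f in pffun_on y0 (mem T) (@predT Y)].
pose A (T : {set S}) (f : {ffun S -> Y}) :=
  [set g | [forall t in T, ev t (f t) g]].
have sub : E \subset \bigcup_(T in X) \bigcup_(f in F T) A T f.
  apply/subsetP => g; rewrite inE => LC.
  have := LC; rewrite -bin_gt0 -cards_draws => /card_gt0P[T].
  rewrite inE => /andP[TC TL].
  apply/bigcupP; exists T.
    rewrite inE TL andbT; apply: subset_trans TC _.
    by apply/subsetP => t; rewrite inE => /andP[].
  pose f : {ffun S -> Y} :=
    [ffun t => if t \in T then odflt y0 [pick y | ev t y g] else y0].
  apply/bigcupP; exists f.
    rewrite inE; apply/pffun_onP; split=> [|//].
    by apply/subsetP => t; rewrite !inE ffunE; case: ifP => //; rewrite eqxx.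
  rewrite inE; apply/forall_inP => t tT; rewrite ffunE tT.
  have /(subsetP TC) := tT; rewrite inE => /andP[_ /existsP[y ety]].
  by case: pickP => [z //|/(_ y)]; rewrite ety.
apply: (@leq_trans ((\sum_(T in X) \sum_(f in F T) #|A T f|) * M)).
  rewrite leq_mul2r; apply/orP; right.
  apply: leq_trans (subset_leq_card sub) _.
  apply: leq_trans (leq_card_bigcup _ _) _.
  by apply: leq_sum => T _; exact: leq_card_bigcup.
rewrite big_distrl /= -mulnA -cards_draws -sum_nat_const.
apply: leq_sum => T; rewrite inE => /andP[TC /eqP TL].
have -> : (#|Y| ^ L = #|F T|)%N.
  by rewrite cardsE card_pffun_on TL cardT.
rewrite big_distrl -sum_nat_const /=; apply: leq_sum => f _.
exact: evM.
Qed.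

(** * Colouring a distributed set *)

(** Greedy induction: remove one element, colour the rest, and give the removed element a colour
    absent from its conflicts. *)
Lemma bounded_degree_coloring (S : finType) (conf : rel S) (Om : {set S})
    (K : nat) : symmetric conf -> reflexive conf ->
  (forall e, e \in Om -> #|[set e' in Om | conf e e']| <= K)%N ->
  exists col : S -> nat, (forall e, e \in Om -> col e < K)%N /\
   {in Om &, forall e e', conf e e' -> col e = col e' -> e = e'}.
Proof.
move=> symc reflc; have [n] := ubnP #|Om|.
elim: n => // n IHn in Om * => Omn deg.
have [->|[e eO]] := set_0Vmem Om.
  by exists (fun=> 0%N); split=> [x|x y]; rewrite inE.
have sub : Om :\ e \subset Om by exact: subsetDl.
have [||col [colK colP]] := IHn (Om :\ e).
- by move: Omn; rewrite (cardsD1 e) eO.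
- move=> e' /(subsetP sub) /deg; apply: leq_trans.
  by apply/subset_leq_card/subsetP => z; rewrite !inE => /andP[/andP[_ ->]].
have [c cP] : exists c : 'I_K,
    forall e', e' \in Om :\ e -> conf e e' -> col e' != c.
  pose N := [set e' in Om :\ e | conf e e'].
  pose F := [set c : 'I_K | [exists e' in N, col e' == c]].
  (* By reflexivity [e] is one of its own at most [K] conflicts, so fewer than [K] colours are
     forbidden. *)
  have FK : (#|F| < K)%N.
    apply: leq_trans (deg _ eO).
    rewrite [X in (_ < X)%N](cardsD1 e) inE eO reflc add1n ltnS.
    have -> : [set e' in Om | conf e e'] :\ e = N.
      by apply/setP => z; rewrite !inE; case: (z == e).
    rewrite -(card_imset _ (@Some_inj _ : injective (@Some 'I_K))).
    apply: leq_trans (leq_imset_card (fun e' => insub (col e')) N).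
    apply/subset_leq_card/subsetP => _ /imsetP[c + ->].
    rewrite inE => /exists_inP[e' e'N /eqP cE].
    by apply/imsetP; exists e'; rewrite // cE valK.
  have /subsetPn[c _ cF] : ~~ ([set: 'I_K] \subset F).
    by apply: contraL FK => /subset_leq_card; rewrite cardsT card_ord -leqNgt.
  exists c => e' e'O cee'; apply: contraNneq cF => cE; rewrite inE.
  by apply/exists_inP; exists e'; rewrite ?cE // inE e'O.
exists (fun z => if z == e then c : nat else col z); split.
  move=> z zO; case: eqP => [_|/eqP ze]; first exact: ltn_ord.
  by apply: colK; rewrite !inE ze.
move=> z1 z2 z1O z2O /=.
case: (eqVneq z1 e) => [->|n1]; case: (eqVneq z2 e) => [->//|n2] cz.
- by move=> ec; move: (cP z2); rewrite !inE n2 z2O ec eqxx cz => /(_ isT isT).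
- rewrite symc in cz.
  by move=> ec; move: (cP z1); rewrite !inE n1 z1O ec eqxx cz => /(_ isT isT).
- by apply: colP; rewrite // !inE ?n1 ?n2.
Qed.

(** The crossed tests serve case (b), where both coordinates name vertices of the same graph: pairs
    without conflict have disjoint vertex sets. *)
Definition vertex_conflict (I : finType) (e f : I * I) :=
  [|| e.1 == f.1, e.2 == f.2, e.1 == f.2 | e.2 == f.1].

(** Each of the four coincidences puts [f] in one row or one column determined by [e], which gives
    at most [4 * d] conflicts. *)
Lemma exists_coloring (I : finType) (d : nat) (Om : {set I * I}) :
  (forall k, #|[set f in Om | f.1 == k]| <= d)%N ->
  (forall k, #|[set f in Om | f.2 == k]| <= d)%N ->
  exists col : I * I -> nat, (forall e, e \in Om -> col e < 4 * d)%N /\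
   {in Om &, forall e f, vertex_conflict e f -> col e = col f -> e = f}.
Proof.
move=> rows cols; apply: bounded_degree_coloring => [e f|e|e _].
- by rewrite /vertex_conflict [e.1 == f.1]eq_sym [e.2 == f.2]eq_sym
    [e.1 == f.2]eq_sym [e.2 == f.1]eq_sym [(f.2 == e.1) || _]orbC.
- by rewrite /vertex_conflict eqxx.
have -> : [set f in Om | vertex_conflict e f] =
    [set f in Om | f.1 == e.1] :|: [set f in Om | f.2 == e.2] :|:
    ([set f in Om | f.2 == e.1] :|: [set f in Om | f.1 == e.2]).
  apply/setP => f; rewrite !inE -!andb_orr /vertex_conflict !orbA.
  by rewrite [e.1 == f.1]eq_sym [e.2 == f.2]eq_sym
    [e.1 == f.2]eq_sym [e.2 == f.1]eq_sym.
apply: leq_trans (leq_card_setU _ _) _.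
apply: leq_trans (leq_add (leq_card_setU _ _) (leq_card_setU _ _)) _.
have -> : (4 * d = d + d + (d + d))%N by lia.
by rewrite !leq_add.
Qed.

(** * Overlaps of edges in a left-regular bipartite graph *)

Section Overlap.
Variables (I : finType) (delta m : nat).
Implicit Types (g : {ffun I * 'I_delta -> 'I_m}) (u v w : I) (e f : I * I).

Definition edges g w (r : 'I_m) : nat := #|[set k | g (w, k) == r]|.

(** This is the inner product of columns [u] and [v] of the biadjacency matrix. *)
Definition common_edges g u v : nat := \sum_r edges g u r * edges g v r.

(* The cells [r = s] are left out: in case (b) every diagonal pair [(i, i)], and
   all of them belong to the support, puts mass there, about [p delta^2 / m] in
   total against [(i, i)], which is far more than [delta^2]. *)
Definition overlap g e f : nat :=
  \sum_r \sum_(s | s != r)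
     edges g e.1 r * edges g e.2 s * (edges g f.1 r * edges g f.2 s).

(** The edges [y] witness a positive overlap of [(u, v)] with [f]. The last conjunct follows from
    [r != s]; it keeps the two left-hand sides distinct even when [f.1 = f.2]. *)
Definition meets g u v (f : I * I)
    (y : ('I_delta * 'I_delta) * ('I_delta * 'I_delta)) : bool :=
  [&& g (u, y.1.1) == g (f.1, y.1.2), g (v, y.2.1) == g (f.2, y.2.2) &
      (f.1, y.1.2) != (f.2, y.2.2)].

Lemma sum_edges_pred g w (P : pred 'I_m) :
  \sum_(r | P r) edges g w r = #|[set k | P (g (w, k))]|.
Proof.
rewrite -sum1_card (partition_big (fun k => g (w, k)) P) => [|k]; last first.
  by rewrite inE.
apply: eq_bigr => r Pr; rewrite /edges -sum1_card; apply: eq_bigl => k.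
by rewrite !inE; case: eqP => [->|]; rewrite ?Pr ?andbF.
Qed.

Lemma sum_edges g w : \sum_r edges g w r = delta.
Proof. by rewrite sum_edges_pred cardsE card_ord. Qed.

(** The successor counts the reference edge [k0], which the hypothesis leaves out. *)
Lemma edges_le g w r n :
  (forall k0, #|[set k in [set~ k0] | [exists y : unit, g (w, k) == g (w, k0)]]|
                <= n)%N ->
  (edges g w r <= n.+1)%N.
Proof.
move=> Hn; rewrite /edges.
have [->|[k0 k0r]] := set_0Vmem [set k | g (w, k) == r].
  by rewrite cards0.
rewrite (cardsD1 k0) k0r ltnS; apply: leq_trans (Hn k0).
move: k0r; rewrite inE => /eqP k0r.
apply/subset_leq_card/subsetP => k; rewrite !inE k0r => /andP[-> kr].
by apply/existsP; exists tt.
Qed.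

(** Only edges of [u] ending at a neighbour of [v] contribute, each at most [a]. *)
Lemma common_edges_le g u v a n : (forall r, edges g v r <= a)%N ->
  (#|[set k in setT | [exists l, g (u, k) == g (v, l)]]| <= n)%N ->
  (common_edges g u v <= a * n)%N.
Proof.
move=> Ha Hn; rewrite /common_edges.
rewrite (bigID (fun r => 0 < edges g v r)%N) /= [X in (_ + X)%N]big1 => [|r];
  last by rewrite -leqNgt leqn0 => /eqP ->; rewrite muln0.
rewrite addn0.
apply: (@leq_trans (\sum_(r | (0 < edges g v r)%N) a * edges g u r)).
  by apply: leq_sum => r _; rewrite mulnC leq_mul2r Ha orbT.
rewrite -big_distrr /= leq_mul2l; apply/orP; right.
rewrite sum_edges_pred; apply: leq_trans Hn.
apply/subset_leq_card/subsetP => k; rewrite !inE /= => /card_gt0P[l].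
by rewrite inE => /eqP gl; apply/existsP; exists l; rewrite gl.
Qed.

Lemma common_edgesxx_le g w a : (forall r, edges g w r <= a)%N ->
  (common_edges g w w <= a * delta)%N.
Proof.
move=> Ha; rewrite -(sum_edges g w) big_distrr; apply: leq_sum => r _.
by rewrite leq_mul2r Ha orbT.
Qed.

Lemma overlap_le g e f :
  (overlap g e f <= common_edges g e.1 f.1 * common_edges g e.2 f.2)%N.
Proof.
rewrite /overlap /common_edges big_distrl; apply: leq_sum => r _ /=.
rewrite big_distrr /= [X in (_ <= X)%N](bigID (fun s => s != r)) /=.
apply: leq_trans (leq_addr _ _); apply: leq_sum => s _.
by rewrite mulnACA.
Qed.

Lemma overlap_gt0 g e f : (0 < overlap g e f)%N ->
  [exists y, meets g e.1 e.2 f y].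
Proof.
rewrite lt0n sum_nat_eq0 negb_forall => /existsP[r] /=.
rewrite sum_nat_eq0 negb_forall => /existsP[s].
rewrite negb_imply -lt0n !muln_gt0 => /andP[sr].
case/andP=> /andP[/card_gt0P[k +] /card_gt0P[l +]]
            /andP[/card_gt0P[k' +] /card_gt0P[l' +]].
rewrite !inE => /eqP gk /eqP gl /eqP gk' /eqP gl'.
apply/existsP; exists ((k, k'), (l, l')); rewrite /meets /= gk gl gk' gl' !eqxx.
by apply: contraNneq sr => kl; rewrite -gl' -gk' kl.
Qed.

(** Expand [delta ^ 2] as a double sum over [r] and [s]. Off the diagonal each term is at most its
    square, which is what [overlap] counts; the diagonal sums to [common_edges]. *)
Lemma overlapxx_ge g e :
  (delta ^ 2 <= overlap g e e + common_edges g e.1 e.2)%N.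
Proof.
have -> : delta ^ 2 = \sum_r \sum_s edges g e.1 r * edges g e.2 s.
  by rewrite -big_distrlr /= !sum_edges.
rewrite /overlap /common_edges -big_split; apply: leq_sum => r _ /=.
rewrite (bigID (fun s => s != r)) /=; apply: leq_add.
  by apply: leq_sum => s _; case: (edges g e.1 r * _) => // n; rewrite leq_pmull.
by rewrite (eq_bigl (pred1 r)) ?big_pred1_eq // => s; rewrite negbK.
Qed.

End Overlap.

(** * Counting the graphs with one of three defects *)

Section BadGraphs.
Variables (I : finType) (delta m : nat) (Om : {set I * I}).
Variables (col : I * I -> nat) (K L : nat).
Implicit Types (g : {ffun I * 'I_delta -> 'I_m}) (u v w : I) (e f : I * I).

Hypothesis col_proper :
  {in Om &, forall e f, vertex_conflict e f -> col e = col f -> e = f}.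

(** Its pairs avoid [u] and [v], and properness of the colouring makes them mutually disjoint; this
    lets their equations be counted as independent. *)
Definition class u v (c : nat) : {set I * I} :=
  [set f in Om | [&& col f == c, f.1 != u, f.1 != v, f.2 != u & f.2 != v]].

(* The idle quantifier gives the event the shape of [card_many_events]. *)
Definition multi_edge g w :=
  [exists k0, 4 <= #|[set k in [set~ k0] |
                       [exists y : unit, g (w, k) == g (w, k0)]]|].

(** Since [m ^ 2] will be at least [p * delta ^ 2], six equations beat the union over pairs of
    vertices by a factor [1 / p], up to powers of [delta]. The threshold 4 in [multi_edge] does the
    same for single vertices. *)
Definition crowded g u v :=
  6 <= #|[set k in setT | [exists l, g (u, k) == g (v, l)]]|.

Definition class_hit g u v c :=
  L <= #|[set f in class u v c | [exists y, meets g u v f y]]|.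

Let total : #|{ffun I * 'I_delta -> 'I_m}| = m ^ #|{: I * 'I_delta}|.
Proof. by rewrite card_ffun card_ord. Qed.

Lemma bin_le_exp n k : 'C(n, k) <= n ^ k.
Proof.
apply: leq_trans (leq_pmulr _ (fact_gt0 k)) _; rewrite bin_ffact.
elim: k => // k IH; rewrite ffactnSr expnSr leq_mul ?leq_subr //.
Qed.

(** The factor [delta ^ 5] pays for the reference edge and four further edges. *)
Lemma card_multi_edge :
  #|[set g | [exists w, multi_edge g w]]| * m ^ 4
    <= #|I| * (delta ^ 5 * m ^ #|{: I * 'I_delta}|).
Proof.
apply: card_exists_mul => // w; rewrite expnS -mulnA.
apply: card_exists_mul => [|k0]; first by rewrite card_ord.
have := @card_many_events _ _ _ tt (fun k _ g => g (w, k) == g (w, k0))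
  [set~ k0] 4 (m ^ 4).
rewrite total => H; apply: leq_trans (H _) _ => [T F /subsetP TC T4|].
  have := @card_eq_system _ 'I_m _ T (fun k => (w, k)) (fun=> (w, k0)).
  rewrite card_ord T4; apply=> [k l _ _ [//]|k l _ lT].
  by have := TC _ lT; rewrite !inE xpair_eqE negb_and eq_sym => ->; rewrite orbT.
rewrite card_unit exp1n muln1 leq_mul2r; apply/orP; right.
apply: leq_trans (bin_le_exp _ _) _; rewrite leq_exp2r //.
by rewrite -[X in _ <= X](card_ord delta) max_card.
Qed.

(** The factor [delta ^ 12] pays for six edges at [u] and a partner at [v] for each. *)
Lemma card_crowded :
  #|[set g | [exists w : I * I, (w.1 != w.2) && crowded g w.1 w.2]]| * m ^ 6
    <= #|{: I * I}| * (delta ^ 12 * m ^ #|{: I * 'I_delta}|).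
Proof.
apply: card_exists_mul => // -[u v] /=.
have [->|uv] := eqVneq u v => /=.
  by rewrite (eq_card0 (A := [set g | false])) // => g; rewrite inE.
have := @card_many_events _ _ _ _ (fun k l g => g (u, k) == g (v, l))
  [set: 'I_delta] 6 (m ^ 6).
rewrite total => H.
have [k0 _|d0] := pickP (fun _ : 'I_delta => true); last first.
  rewrite (eq_card0 (A := [set g | _])) // => g; rewrite inE /crowded.
  by rewrite (eq_card0 (A := [set k in setT | _])) // => k; move: (d0 k).
apply: leq_trans (H k0 _) _ => [T F _ T6|].
  have := @card_eq_system _ 'I_m _ T (fun k => (u, k)) (fun k => (v, F k)).
  rewrite card_ord T6; apply=> [k l _ _ [//]|k l _ _].
  by rewrite xpair_eqE eq_sym (negbTE uv).
rewrite leq_mul2r cardsT !card_ord; apply/orP; right.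
by rewrite (expnD _ 6 6) leq_mul2r bin_le_exp orbT.
Qed.

(** Two pairs of the same colour cannot share a first vertex, so the first projection is injective
    on a class. *)
Lemma card_class u v c : #|class u v c| <= #|I|.
Proof.
rewrite -(@card_in_imset _ _ fst) ?max_card // => e f.
rewrite !inE => /and3P[eO /eqP ec _] /and3P[fO /eqP fc _] ef.
by apply: col_proper; rewrite /vertex_conflict ?ef ?eqxx ?ec ?fc.
Qed.

(** Each of [L] pairs in a class yields two equations, with four edges to choose. The left-hand
    sides sit at the vertices of the pairs, the right-hand sides at [u] and [v]. *)
Lemma card_class_hit :
  #|[set g | [exists w : I * I, exists c : 'I_K, class_hit g w.1 w.2 c]]|
     * m ^ (2 * L)
    <= #|{: I * I}| * (K * ('C(#|I|, L) * delta ^ (4 * L)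
         * m ^ #|{: I * 'I_delta}|)).
Proof.
apply: card_exists_mul => // -[u v] /=.
apply: card_exists_mul => [|c]; first by rewrite card_ord.
have [k0 _|d0] := pickP (fun _ : 'I_delta => true); last first.
  case: (posnP L) => [->|L0].
    by rewrite muln0 !expn0 bin0 !mul1n muln1 -total max_card.
  rewrite (eq_card0 (A := [set g | _])) // => g; rewrite inE /class_hit.
  rewrite (eq_card0 (A := [set f in _ | _])) => [|f]; first by rewrite leqNgt L0.
  rewrite !inE; apply/negP => /andP[_ /existsP[[[k _] _] _]]; by move: (d0 k).
have := @card_many_events _ _ _ ((k0, k0), (k0, k0))
  (fun f y g => meets g u v f y) (class u v c) L (m ^ (2 * L)).
rewrite total => H; apply: leq_trans (H _) _ => [T F /subsetP TC TL|].
  (* If the chosen edges make the two left-hand sides of some pair coincide, [meets] fails there and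
     the event is empty. *)
  have [f0 /andP[f0T f0F]|nF] := pickP [pred f | (f \in T) &&
      ((f.1, (F f).1.2) == (f.2, (F f).2.2))].
    rewrite (eq_card0 (A := [set g | _])) // => g; rewrite inE.
    apply/negP => /forall_inP/(_ _ f0T)/and3P[_ _].
    by rewrite f0F.
  (* The [2 * L] equations are indexed by a pair and a boolean selecting its coordinate. *)
  pose x (j : (I * I) * bool) := if j.2 then (j.1.1, (F j.1).1.2)
                                 else (j.1.2, (F j.1).2.2).
  pose y (j : (I * I) * bool) := if j.2 then (u, (F j.1).1.1)
                                 else (v, (F j.1).2.1).
  pose D := setX T [set: bool].
  have DL : #|D| = 2 * L by rewrite cardsX TL cardsT card_bool mulnC.
  have := @card_eq_system _ 'I_m _ D x y.
  rewrite card_ord DL => H2; apply: leq_trans (H2 _ _) => [|j1 j2|j1 j2].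
  - rewrite leq_mul2r; apply/orP; right.
    apply/subset_leq_card/subsetP => g; rewrite !inE => /forall_inP gT.
    apply/forall_inP => -[f b] /=; rewrite !inE /= andbT => /gT /and3P[e1 e2 _].
    by case: b; rewrite /x /y /= eq_sym.
  - case: j1 j2 => [f1 b1] [f2 b2]; rewrite !inE /= !andbT => f1T f2T.
    have := TC _ f1T; have := TC _ f2T.
    rewrite !inE => /and3P[f2O /eqP f2c _] /and3P[f1O /eqP f1c _] ex.
    have f12 : f1 = f2.
      apply: col_proper => //; last by rewrite f1c f2c.
      by rewrite /vertex_conflict; case: b1 b2 ex => [] [] [-> _]; rewrite eqxx ?orbT.
    subst f2; move: (nF f1); rewrite /= f1T /=.
    by case: b1 b2 ex => [] [] //; rewrite /x /= => ->; rewrite eqxx.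
  - case: j1 j2 => [f1 b1] [f2 b2]; rewrite !inE /= !andbT => _ /TC.
    rewrite !inE => /and5P[_ _ n1 n2 /andP[n3 n4]].
    by case: b1 b2 => [] []; rewrite /x /y /= xpair_eqE negb_and eq_sym
       ?n1 ?n2 ?n3 ?n4.
rewrite leq_mul2r; apply/orP; right; apply: leq_mul.
  by apply: leq_bin2l; exact: card_class.
by rewrite !card_prod !card_ord expnM !expnS expn0 muln1 -!mulnA.
Qed.

End BadGraphs.

(** * Small overlaps in a graph without defects *)

Section GoodGraph.
Variables (I : finType) (delta m d : nat) (Om : {set I * I}).
Variables (col : I * I -> nat) (K L : nat).
Variable g : {ffun I * 'I_delta -> 'I_m}.

Hypothesis rows : forall k, #|[set f in Om | f.1 == k]| <= d.
Hypothesis cols : forall k, #|[set f in Om | f.2 == k]| <= d.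
Hypothesis colK : forall f, f \in Om -> col f < K.
Hypothesis delta5 : 5 <= delta.
Hypothesis simple : forall w, ~~ multi_edge g w.
Hypothesis sparse : forall u v, u != v -> ~~ crowded g u v.
Hypothesis rare : forall u v c, c < K -> ~~ class_hit Om col L g u v c.

Let edges4 w r : edges g w r <= 4.
Proof.
apply: edges_le => k0; have := simple w; rewrite negb_exists => /forallP/(_ k0).
by rewrite -ltnNge.
Qed.

(** Multiplicities are at most 4, and for [u != v] at most five edges of [u] end at a neighbour of
    [v]: hence [20 = 4 * 5]. *)
Lemma common_edges_good u v :
  common_edges g u v <= if u == v then 4 * delta else 20.
Proof.
case: eqVneq => [<-|uv]; first by apply: common_edgesxx_le.
by apply: (@common_edges_le _ _ _ _ _ _ 4 5) => //;
  have := sparse uv; rewrite -ltnNge.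
Qed.

Let overlap_near e f : f != e -> overlap g e f <= 80 * delta.
Proof.
(* One shared coordinate gives [4 * delta * 20]; none gives [20 * 20], which is at most [80 * delta]
   because [5 <= delta]. *)
move=> fe; apply: leq_trans (overlap_le _ _ _) _.
have := common_edges_good e.1 f.1; have := common_edges_good e.2 f.2.
case: eqP => [e2|_]; case: eqP => [e1|_] le2 le1.
- by move: fe; rewrite [e]surjective_pairing [f]surjective_pairing e1 e2 eqxx.
- by apply: leq_trans (leq_mul le1 le2) _; lia.
- by apply: leq_trans (leq_mul le1 le2) _; lia.
- by apply: leq_trans (leq_mul le1 le2) _; lia.
Qed.

Let overlap_far e f : f.1 != e.1 -> f.2 != e.2 ->
  overlap g e f <= 400 * [exists y, meets g e.1 e.2 f y].
Proof.
move=> n1 n2; case: (posnP (overlap g e f)) => [-> //|/overlap_gt0 ->].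
apply: leq_trans (overlap_le _ _ _) _.
have := common_edges_good e.1 f.1; have := common_edges_good e.2 f.2.
rewrite ![e.1 == _]eq_sym ![e.2 == _]eq_sym (negbTE n1) (negbTE n2) => le2 le1.
exact: leq_trans (leq_mul le1 le2) _.
Qed.

(** At most [4 * d] pairs share a vertex with [e], each contributing at most [80 * delta]. The
    others are summed class by class: fewer than [L] of each colour meet [e], each contributing at
    most 400. *)
Lemma incoherence e :
  \sum_(f in Om | f != e) overlap g e f <= 400 * (K * L) + 320 * (d * delta).
Proof.
pose near f := [|| f.1 == e.1, f.1 == e.2, f.2 == e.1 | f.2 == e.2].
rewrite (bigID near) /= addnC; apply: leq_add.
  apply: (@leq_trans (\sum_(f in Om | ~~ near f) overlap g e f)).
    rewrite [X in _ <= X](bigID (fun f => f != e)) /=.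
    apply: leq_trans (leq_addr _ _); rewrite leq_eqVlt; apply/orP; left.
    by apply/eqP; apply: eq_bigl => f; rewrite andbAC.
  apply: (@leq_trans (\sum_(f in Om | ~~ near f)
                        \sum_(c < K | col f == c) overlap g e f)).
    apply: leq_sum => f /andP[fO _].
    by rewrite (big_pred1 (Ordinal (colK fO))) // => c; rewrite eq_sym.
  rewrite (exchange_big_dep predT) //= mulnCA.
  rewrite -[X in _ <= X * _](card_ord K) -sum_nat_const.
  apply: leq_sum => c _.
  apply: (@leq_trans (\sum_(f in class Om col e.1 e.2 c)
                        400 * [exists y, meets g e.1 e.2 f y])).
    rewrite [X in _ <= X](eq_bigl (fun f =>
      (f \in Om) && ~~ near f && (col f == c))).
      apply: leq_sum => f /andP[/andP[_]].
      by rewrite /near !negb_or => /and4P[n1 _ _ n2] _; apply: overlap_far.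
    move=> f; rewrite inE /near !negb_or; case: (f \in Om) => //=.
    by rewrite andbC.
  rewrite -big_distrr leq_mul2l /=.
  have := rare e.1 e.2 (ltn_ord c); rewrite -ltnNge => /ltnW; apply: leq_trans.
  rewrite -sum1_card big_mkcond [X in _ <= X]big_mkcond leq_sum // => f _.
  by rewrite !inE; case: ifP => // _; case: [exists y, _].
apply: (@leq_trans (\sum_(f in [set f in Om | near f]) 80 * delta)).
  rewrite [X in _ <= X](eq_bigl (fun f => (f \in Om) && near f)) => [|f];
    last by rewrite inE.
  rewrite [X in _ <= X](bigID (fun f => f != e)) /=.
  apply: leq_trans (leq_addr _ _).
  rewrite (eq_bigl (fun f => (f \in Om) && near f && (f != e))) => [|f];
    last by rewrite andbAC.
  by apply: leq_sum => f /andP[_]; exact: overlap_near.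
rewrite sum_nat_const.
apply: (@leq_trans (4 * d * (80 * delta))); last by lia.
rewrite leq_mul2r; apply/orP; right.
have -> : [set f in Om | near f] =
    [set f in Om | f.1 == e.1] :|: [set f in Om | f.1 == e.2] :|:
    ([set f in Om | f.2 == e.1] :|: [set f in Om | f.2 == e.2]).
  by apply/setP => f; rewrite !inE /near -!andb_orr !orbA.
apply: leq_trans (leq_card_setU _ _) _.
apply: leq_trans (leq_add (leq_card_setU _ _) (leq_card_setU _ _)) _.
have -> : 4 * d = d + d + (d + d) by lia.
by rewrite !leq_add.
Qed.

End GoodGraph.

(** * From small overlaps to stable recovery *)

Local Open Scope ring_scope.

(** Isolate the term [e = f] in the equation for [f], take absolute values, sum over [f] in [Om] and
    exchange the sums. *)
Lemma diagonally_dominant_nullspace (R : realType) (E : finType) (Om : {set E})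
    (K : E -> E -> R) (V : E -> R) (a b : R) :
  (forall e f, 0 <= K e f) ->
  (forall f, f \in Om -> \sum_e V e * K e f = 0) ->
  (forall f, f \in Om -> a <= K f f) ->
  (forall e, \sum_(f in Om | f != e) K e f <= b) ->
  a * \sum_(f in Om) `|V f| <= b * \sum_e `|V e|.
Proof.
move=> K0 VK diag off.
have le f : f \in Om -> a * `|V f| <= \sum_(e | e != f) `|V e| * K e f.
  move=> fO; apply: (@le_trans _ _ (`|V f| * K f f)).
    by rewrite mulrC ler_wpM2l ?diag.
  have := VK _ fO; rewrite (bigD1 f) //= => /eqP; rewrite addr_eq0 => /eqP VE.
  rewrite -[X in _ * X]ger0_norm // -normrM VE normrN.
  apply: (le_trans (ler_norm_sum _ _ _)); apply: ler_sum => e _.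
  by rewrite normrM [X in _ * X]ger0_norm.
rewrite mulr_sumr.
apply: (@le_trans _ _ (\sum_(f in Om) \sum_(e | e != f) `|V e| * K e f)).
  by apply: ler_sum => f; exact: le.
rewrite (exchange_big_dep predT) //= mulr_sumr; apply: ler_sum => e _.
rewrite -mulr_sumr mulrC ler_wpM2r //.
by under eq_bigl => f do rewrite eq_sym; exact: off.
Qed.

Lemma l1normE (R : realType) (p : nat) (M : 'M[R]_p) :
  l1norm M = \sum_(x : 'I_p * 'I_p) `|M x.1 x.2|.
Proof. by rewrite /l1norm pair_big. Qed.

(** Optimality, the triangle inequality and the bound of one third on [Om] give
    [l1norm W <= 6 * l1norm N]; adding [N] costs one more. *)
Lemma l1_stability (R : realType) (p : nat) (Om : {set 'I_p * 'I_p})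
    (X N W : 'M[R]_p) :
  [set x | X x.1 x.2 != 0] \subset Om ->
  3 * (\sum_(x in Om) `|W x.1 x.2|) <= l1norm W ->
  l1norm (X + N + W) <= l1norm (X + N) ->
  l1norm (N + W) <= 7 * l1norm N.
Proof.
move=> /subsetP suppX.
have X0 x : x \notin Om -> X x.1 x.2 = 0.
  by move=> xO; apply/eqP; apply: contraNT xO => Xx; rewrite suppX ?inE.
rewrite !l1normE => WO opt.
have tri1 : \sum_x `|(X + N) x.1 x.2| <= \sum_x `|X x.1 x.2| + \sum_x `|N x.1 x.2|.
  by rewrite -big_split; apply: ler_sum => x _; rewrite mxE ler_normD.
have tri2 : \sum_x `|(N + W) x.1 x.2| <= \sum_x `|N x.1 x.2| + \sum_x `|W x.1 x.2|.
  by rewrite -big_split; apply: ler_sum => x _; rewrite mxE ler_normD.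
(* Checked entrywise: on [Om], [X] is [X + N + W] minus [N + W]; off [Om], [X] vanishes and [W] is
   [N + W] minus [N]. *)
have low : \sum_x `|X x.1 x.2| + \sum_x `|W x.1 x.2| <=
    \sum_x `|(X + N + W) x.1 x.2| + \sum_x `|N x.1 x.2| +
      2 * \sum_(x in Om) `|W x.1 x.2|.
  rewrite [\sum_(x in Om) _]big_mkcond mulr_sumr -!big_split /=.
  apply: ler_sum => x _; rewrite !mxE; case: ifPn => [_|/X0 ->].
    have := ler_normB (X x.1 x.2 + N x.1 x.2 + W x.1 x.2) (N x.1 x.2 + W x.1 x.2).
    have := ler_normD (N x.1 x.2) (W x.1 x.2).
    have -> : X x.1 x.2 + N x.1 x.2 + W x.1 x.2 - (N x.1 x.2 + W x.1 x.2) = X x.1 x.2.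
      by ring.
    lra.
  have := ler_normB (0 + N x.1 x.2 + W x.1 x.2) (N x.1 x.2).
  have -> : 0 + N x.1 x.2 + W x.1 x.2 - N x.1 x.2 = W x.1 x.2 by ring.
  rewrite normr0; lra.
lra.
Qed.

(** * Recovery from a graph without defects *)

Section GoodRecovery.
Variables (R : realType) (I : finType) (p delta m d : nat).
Variables (al be : 'I_p -> I).
Hypotheses (al_inj : injective al) (be_inj : injective be).

(** The map [al] says which left vertices serve as columns, so that one graph supplies both
    measurement matrices. *)
Definition column_matrix (g : {ffun I * 'I_delta -> 'I_m}) (al : 'I_p -> I) :
  'M[R]_(m, p) := \matrix_(r, i) (edges g (al i) r)%:R.

Let ab (x : 'I_p * 'I_p) := (al x.1, be x.2).

Let ab_inj : injective ab.
Proof. by move=> [i j] [k l] [/al_inj -> /be_inj ->]. Qed.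

Lemma card_image_row (Om : {set 'I_p * 'I_p}) : distributed d Om ->
  forall k, (#|[set f in ab @: Om | f.1 == k]| <= d)%N.
Proof.
move=> [_ Od] k; have [i /eqP <-|nk] := pickP (fun i => al i == k); last first.
  rewrite eq_card0 // => f; rewrite !inE; apply/andP => -[/imsetP[x _ ->]].
  by rewrite nk.
apply: leq_trans (Od i).1; rewrite -(card_imset _ ab_inj); apply: subset_leq_card.
apply/subsetP => f; rewrite !inE => /andP[/imsetP[x xO ->] /= /eqP/al_inj xi].
by apply/imsetP; exists x; rewrite // inE xO xi eqxx.
Qed.

Lemma card_image_col (Om : {set 'I_p * 'I_p}) : distributed d Om ->
  forall k, (#|[set f in ab @: Om | f.2 == k]| <= d)%N.
Proof.
move=> [_ Od] k; have [i /eqP <-|nk] := pickP (fun i => be i == k); last first.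
  rewrite eq_card0 // => f; rewrite !inE; apply/andP => -[/imsetP[x _ ->]].
  by rewrite nk.
apply: leq_trans (Od i).2; rewrite -(card_imset _ ab_inj); apply: subset_leq_card.
apply/subsetP => f; rewrite !inE => /andP[/imsetP[x xO ->] /= /eqP/be_inj xi].
by apply/imsetP; exists x; rewrite // inE xO xi eqxx.
Qed.

(** The sum is the combination of the off-diagonal entries [(r, s)] of the vanishing product with
    weights [edges g (al f.1) r * edges g (be f.2) s]. *)
Lemma overlap_orthogonal g (W : 'M[R]_p) f :
  column_matrix g al *m W *m (column_matrix g be)^T = 0 ->
  \sum_e W e.1 e.2 * (overlap g (ab e) (ab f))%:R = 0.
Proof.
move=> AWB.
transitivity (\sum_r \sum_(s | s != r)
   (edges g (al f.1) r)%:R * (edges g (be f.2) s)%:R *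
   (column_matrix g al *m W *m (column_matrix g be)^T) r s); last first.
  by rewrite AWB big1 // => r _; rewrite big1 // => s _; rewrite mxE mulr0.
rewrite /overlap.
under eq_bigr => e _ do rewrite natr_sum mulr_sumr.
rewrite exchange_big; apply: eq_bigr => r _ /=.
under eq_bigr => e _ do rewrite natr_sum mulr_sumr.
rewrite exchange_big; apply: eq_bigr => s _ /=.
rewrite mxE mulr_sumr -(pair_big predT predT (fun i j => W i j *
  (edges g (al i) r * edges g (be j) s *
   (edges g (al f.1) r * edges g (be f.2) s))%:R)) /= exchange_big.
apply: eq_bigr => j _ /=; rewrite mxE mulr_suml mulr_sumr.
apply: eq_bigr => i _; rewrite !mxE !natrM; ring.
Qed.

(** The numerical hypothesis makes three times the incoherence bound at most
    [delta ^ 2 - 4 * delta], a lower bound for every diagonal overlap. *)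
Lemma good_recovery (Om : {set 'I_p * 'I_p}) (X N Xs : 'M[R]_p) g
    (col : I * I -> nat) (K L : nat) :
  distributed d Om -> [set x | X x.1 x.2 != 0] \subset Om ->
  (5 <= delta)%N ->
  (3 * (400 * (K * L) + 320 * (d * delta)) + 4 * delta <= delta ^ 2)%N ->
  (forall f, f \in ab @: Om -> col f < K)%N ->
  (forall w, ~~ multi_edge g w) ->
  (forall u v, u != v -> ~~ crowded g u v) ->
  (forall u v c, (c < K)%N -> ~~ class_hit (ab @: Om) col L g u v c) ->
  l1_optimal (column_matrix g al) (column_matrix g be) (X + N) Xs ->
  l1norm (Xs - X) <= 7 * l1norm N.
Proof.
move=> Od suppX d5 num colK simple sparse rare [feas opt].
pose W := Xs - (X + N).
have XsE : Xs = X + N + W by rewrite /W addrC subrK.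
have -> : Xs - X = N + W by rewrite XsE -(addrA X N W) [X + _]addrC addrK.
have AWB : column_matrix g al *m W *m (column_matrix g be)^T = 0.
  by rewrite /W mulmxBr mulmxBl feas subrr.
apply: (l1_stability suppX); last by rewrite -XsE; exact: opt.
pose S := (400 * (K * L) + 320 * (d * delta))%N.
have := @diagonally_dominant_nullspace R _ Om
  (fun e f => (overlap g (ab e) (ab f))%:R) (fun e => W e.1 e.2)
  ((delta ^ 2)%:R - (4 * delta)%:R) S%:R.
rewrite -l1normE => H.
have {}H : ((delta ^ 2)%:R - (4 * delta)%:R) * (\sum_(f in Om) `|W f.1 f.2|) <=
    S%:R * l1norm W.
  apply: H => [e f|f _|f fO|e]; first exact: ler0n.
  - exact: overlap_orthogonal.
  - rewrite lerBlDr -natrD ler_nat.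
    apply: leq_trans (overlapxx_ge g (ab f)) _; rewrite leq_add2l.
    apply: leq_trans (common_edges_good simple sparse _ _) _.
    by case: ifP => // _; lia.
  - rewrite -natr_sum ler_nat.
    have := incoherence (card_image_row Od) (card_image_col Od) colK d5 simple
      sparse rare (ab e).
    apply: leq_trans; rewrite leq_eqVlt; apply/orP; left; apply/eqP.
    rewrite [RHS]big_mkcondr big_imset /=; last by move=> x y _ _ /ab_inj.
    by rewrite -big_mkcondr; apply: eq_bigl => f; rewrite (inj_eq ab_inj).
have d0 : 0 < (delta ^ 2)%:R - (4 * delta)%:R :> R.
  by rewrite subr_gt0 ltr_nat; nia.
rewrite -(ler_pM2l d0); have l0 : 0 <= l1norm W.
  by rewrite l1normE; apply: sumr_ge0.
have : (3 * S + 4 * delta <= delta ^ 2)%N by [].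
rewrite -(ler_nat R) natrD natrM => le3S.
have := @ler_wpM2r _ _ l0 (3%:R * S%:R) ((delta ^ 2)%:R - (4 * delta)%:R).
by rewrite lerBrDr => /(_ le3S); lra.
Qed.

End GoodRecovery.

(** * Failure probability *)

(** Bound the binomial by [q ^ L / L!]; the hypothesis turns the whole into
    [(L * exp(-2)) ^ L / L!], and [L ^ L / L!] is a term of the series of [exp L]. *)
Lemma poisson_tail (R : realType) (q L delta m : nat) :
  (0 < m)%N ->
  q%:R * delta%:R ^+ 4 <= L%:R * expR (- 2) * m%:R ^+ 2 :> R ->
  'C(q, L)%:R * delta%:R ^+ (4 * L) / m%:R ^+ (2 * L) <= expR (- L%:R) :> R.
Proof.
move=> m0 H.
have M0 : 0 < m%:R ^+ 2 :> R by rewrite exprn_gt0 // ltr0n.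
have F0 : 0 < L`!%:R :> R by rewrite ltr0n fact_gt0.
have binF : 'C(q, L)%:R <= q%:R ^+ L / L`!%:R :> R.
  rewrite ler_pdivlMr // -natrM bin_ffact -natrX ler_nat.
  elim: L {H F0} => // k IH; rewrite ffactnSr expnSr leq_mul ?leq_subr //.
apply: (@le_trans _ _ ((q%:R * delta%:R ^+ 4 / m%:R ^+ 2) ^+ L / L`!%:R)).
  have -> : 'C(q, L)%:R * delta%:R ^+ (4 * L) / m%:R ^+ (2 * L) =
      'C(q, L)%:R * (delta%:R ^+ 4 / m%:R ^+ 2) ^+ L :> R.
    by rewrite exprMn exprVn -!exprM mulrA.
  rewrite -(mulrA q%:R) (exprMn L q%:R) (mulrAC _ _ L`!%:R^-1).
  rewrite ler_wpM2r // exprn_ge0 //.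
  by rewrite divr_ge0 // exprn_ge0.
apply: (@le_trans _ _ ((L%:R * expR (- 2)) ^+ L / L`!%:R)).
  rewrite ler_pM2r ?invr_gt0 // lerXn2r ?nnegrE //.
  - by rewrite divr_ge0 // ?mulr_ge0 ?exprn_ge0 // ltW.
  - by rewrite mulr_ge0 ?expR_ge0.
  - by rewrite ler_pdivrMr.
have -> : expR (- L%:R) = expR (- 2) ^+ L * expR L%:R :> R.
  by rewrite -expRM_natl -expRD; congr expR; rewrite -mulr_natr; ring.
rewrite exprMn mulrAC mulrC ler_wpM2l ?exprn_ge0 ?expR_ge0 //.
case: L {H F0 binF} => [|k]; first by rewrite expr0 fact0 divr1 expR0.
by apply: le_trans (expR_ge1Dxn k _); rewrite ?lerDr ?ler0n.
Qed.

(* The constant makes [3 * 400 * (4 * d * L)] at most half of [delta ^ 2], where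
   400 bounds a single overlap without common vertex. *)
Definition hits_bound (delta d : nat) : nat := (delta ^ 2 %/ (96 * 100 * d))%N.

(** The terms without [hits_bound] fit into the other half of [delta ^ 2], since [delta] is large
    compared with [d]. *)
Lemma hits_bound_le (delta d : nat) : (0 < d)%N -> (576 * 100 * d <= delta)%N ->
  (3 * (400 * (4 * d * hits_bound delta d) + 320 * (d * delta)) + 4 * delta
     <= delta ^ 2)%N.
Proof.
move=> d0 dd; rewrite /hits_bound.
have := leq_divM (delta ^ 2) (96 * 100 * d).
by set L := (_ %/ _)%N; nia.
Qed.

(** The quotient is at least 1, so its floor is at least half of it. *)
Lemma hits_bound_ge (delta d : nat) : (0 < d)%N -> (576 * 100 * d <= delta)%N ->
  (delta ^ 2 <= 192 * 100 * d * hits_bound delta d)%N.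
Proof.
move=> d0 dd; rewrite /hits_bound.
have h : (96 * 100 * d <= delta ^ 2)%N by nia.
have c0 : (0 < 96 * 100 * d)%N by rewrite !muln_gt0.
have := ltn_ceil (delta ^ 2) c0.
have : (0 < delta ^ 2 %/ (96 * 100 * d))%N by rewrite divn_gt0.
by set L := (_ %/ _)%N; nia.
Qed.

(** The three counts divided by the number of graphs, [q] being the number of left vertices and
    [4 * d] the number of colours. *)
Definition failure_bound (R : realType) (q delta m d : nat) : R :=
  q%:R * delta%:R ^+ 5 / m%:R ^+ 4 + q%:R ^+ 2 * delta%:R ^+ 12 / m%:R ^+ 6 +
  q%:R ^+ 2 * (4 * d)%:R * ('C(q, hits_bound delta d)%:R *
    delta%:R ^+ (4 * hits_bound delta d) / m%:R ^+ (2 * hits_bound delta d)).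

(** Every term is a polynomial in [delta] and [d] over [p], so it suffices that [22 * d * delta ^ 6]
    be less than [s], the square root of [p]. The degree 7 term of the exponential series at [y / 2]
    ensures this, and dictates the lower bound on [y]. *)
Lemma failure_bound_lt (R : realType) (p q delta m d : nat) (y : R) :
  p%:R = expR y -> (0 < d)%N ->
  1408 * 128 * 7`!%:R * d%:R <= y -> y <= delta%:R <= 2 * y ->
  40 * 1000 * expR 2 * d%:R * p%:R * delta%:R ^+ 2 <= m%:R ^+ 2 :> R ->
  (q <= 2 * p)%N ->
  failure_bound R q delta m d < expR (- (y / 2)).
Proof.
move=> pE d0 ylarge /andP[ydelta deltay] mlarge qp.
set s := expR (y / 2).
have s0 : 0 < s by apply: expR_gt0.
have Ps : p%:R = s ^+ 2 by rewrite pE -expRM_natl; congr expR; lra.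
have f1 : 1 <= 7`!%:R :> R by rewrite ler1n fact_gt0.
have d1 : 1 <= d%:R :> R by rewrite ler1n.
have yd : 1408 * 128 * d%:R <= y by apply: le_trans ylarge; nra.
have dd : (576 * 100 * d <= delta)%N.
  rewrite -(ler_nat R) natrM; apply: le_trans ydelta; apply: le_trans yd.
  by rewrite natrM; lra.
have y0 : 1 <= y by lra.
have e2 : 1 <= expR 2 :> R by apply: le_trans (expR_ge1Dx _); lra.
have p0 : 0 < p%:R :> R by rewrite pE expR_gt0.
have D0 : 1 <= delta%:R :> R by lra.
have qP : q%:R <= 2 * p%:R :> R by rewrite -natrM ler_nat.
have q0 : 0 <= q%:R :> R by [].
have D2 : 1 <= delta%:R ^+ 2 :> R by rewrite exprn_ege1.
have M2 : p%:R * delta%:R ^+ 2 <= m%:R ^+ 2 :> R.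
  apply: le_trans mlarge; rewrite -(mulrA _ p%:R) ler_peMl; first by [].
    by rewrite mulr_ge0 ?exprn_ge0 //; lra.
  by rewrite -mulrA; nra.
have Mpos : 0 < m%:R ^+ 2 :> R.
  by apply: lt_le_trans M2; rewrite mulr_gt0 // (lt_le_trans ltr01 D2).
have m0 : (0 < m)%N.
  by case: m Mpos {M2 mlarge} => //; rewrite expr0n /= ltxx.
have Pm0 : 0 <= p%:R * delta%:R ^+ 2 :> R by rewrite mulr_ge0 ?exprn_ge0 ?ler0n.
have Xk k : (p%:R * delta%:R ^+ 2) ^+ k <= m%:R ^+ (2 * k) :> R.
  by rewrite exprM lerXn2r // nnegrE ltW.
have Mk k : 0 < m%:R ^+ k :> R by rewrite exprn_gt0 // ltr0n.
have D0' : 0 <= delta%:R :> R by exact: le_trans ler01 D0.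
have y0' : 0 <= y by exact: le_trans ler01 y0.
have t1 : q%:R * delta%:R ^+ 5 / m%:R ^+ 4 <= 2 * delta%:R / p%:R :> R.
  rewrite ler_pdivrMr // (mulrAC _ p%:R^-1) ler_pdivlMr //.
  apply: le_trans (_ : 2 * delta%:R * (p%:R * delta%:R ^+ 2) ^+ 2 <= _).
    have -> : 2 * delta%:R * (p%:R * delta%:R ^+ 2) ^+ 2 =
      2 * p%:R * delta%:R ^+ 5 * p%:R :> R by ring.
    by rewrite !ler_wpM2r ?exprn_ge0 // ltW.
  by rewrite ler_wpM2l ?mulr_ge0 // (Xk 2).
have q2 : q%:R ^+ 2 <= 4 * p%:R ^+ 2 :> R.
  have -> : 4 * p%:R ^+ 2 = (2 * p%:R) ^+ 2 :> R by ring.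
  by rewrite lerXn2r // nnegrE mulr_ge0 // ltW.
have t2 : q%:R ^+ 2 * delta%:R ^+ 12 / m%:R ^+ 6 <= 4 * delta%:R ^+ 6 / p%:R :> R.
  rewrite ler_pdivrMr // (mulrAC _ p%:R^-1) ler_pdivlMr //.
  apply: le_trans (_ : 4 * delta%:R ^+ 6 * (p%:R * delta%:R ^+ 2) ^+ 3 <= _).
    have -> : 4 * delta%:R ^+ 6 * (p%:R * delta%:R ^+ 2) ^+ 3 =
      4 * p%:R ^+ 2 * delta%:R ^+ 12 * p%:R :> R by ring.
    by rewrite !ler_wpM2r ?exprn_ge0 // ltW.
  by rewrite ler_wpM2l ?mulr_ge0 ?exprn_ge0 // (Xk 3).
have t3 : q%:R ^+ 2 * (4 * d)%:R * ('C(q, hits_bound delta d)%:R *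
    delta%:R ^+ (4 * hits_bound delta d) / m%:R ^+ (2 * hits_bound delta d))
    <= 16 * d%:R / p%:R :> R.
  have := hits_bound_ge d0 dd; set L := hits_bound delta d.
  rewrite -(ler_nat R) natrX !natrM => Lge.
  have tail : 'C(q, L)%:R * delta%:R ^+ (4 * L) / m%:R ^+ (2 * L)
      <= expR (- L%:R) :> R.
    (* The factor [40 * 1000] covers twice the [192 * 100] of [hits_bound_ge], the 2 coming from
       [q <= 2 * p]. *)
    apply: poisson_tail => //.
    apply: le_trans (_ : L%:R * expR (- 2) * (40 * 1000 * expR 2 * d%:R * p%:R *
      delta%:R ^+ 2) <= _); last by rewrite ler_wpM2l ?mulr_ge0 ?expR_ge0.
    rewrite [X in _ <= X](_ : _ = (40 * 1000 * d%:R * L%:R) *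
       (p%:R * delta%:R ^+ 2) * (expR (- 2) * expR 2)); last by ring.
    rewrite -expRD addNr expR0 mulr1.
    apply: le_trans (_ : 2 * delta%:R ^+ 2 * (p%:R * delta%:R ^+ 2) <= _).
      rewrite [X in _ <= X](_ : _ = 2 * p%:R * delta%:R ^+ 4); last by ring.
      by rewrite ler_wpM2r ?exprn_ge0.
    have dL : 0 <= d%:R * L%:R :> R by rewrite mulr_ge0 ?ler0n.
    by rewrite ler_wpM2r //; clear - Lge dL; lra.
  (* As [576 = 3 * 192], the lower bound on [delta] gives [3 * y <= L]; then [expR (- L)] is at most
     [p ^- 3], which beats the [q ^ 2] pairs. *)
  have L3 : 3 * y <= L%:R.
    have h : 192 * 100 * d%:R * (3 * y) <= 192 * 100 * d%:R * L%:R.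
      apply: le_trans Lge; rewrite expr2.
      have : (576 * 100 * d)%:R <= delta%:R :> R by rewrite ler_nat.
      rewrite !natrM => dd'; have -> : 192 * 100 * d%:R * (3 * y) =
        576 * 100 * d%:R * y by ring.
      by apply: ler_pM; rewrite ?mulr_ge0 // (le_trans ler01 y0).
    by move: h; rewrite ler_pM2l // !mulr_gt0 // (lt_le_trans ltr01 d1).
  have P3 : expR (- L%:R) <= (p%:R ^+ 3)^-1 :> R.
    by rewrite pE -expRM_natl -expRN ler_expR lerN2.
  apply: le_trans (_ : 4 * p%:R ^+ 2 * (4 * d%:R) * (p%:R ^+ 3)^-1 <= _).
    apply: ler_pM (le_trans tail P3).
    - by rewrite !mulr_ge0 ?exprn_ge0 ?ler0n.
    - by rewrite !mulr_ge0 ?invr_ge0 ?exprn_ge0 ?ler0n.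
    - by rewrite ler_wpM2r ?mulr_ge0 ?ler0n.
  rewrite le_eqVlt; apply/orP; left; apply/eqP; field.
  by rewrite gt_eqF.
apply: (@le_lt_trans _ _ (22 * d%:R * delta%:R ^+ 6 / p%:R)).
  apply: le_trans (lerD (lerD t1 t2) t3) _.
  rewrite -!mulrDl ler_pM2r ?invr_gt0 //.
  have D6 : delta%:R <= delta%:R ^+ 6 :> R by rewrite exprS ler_peMr ?exprn_ege1.
  by clear - D6 D0 d1; nra.
have -> : expR (- (y / 2)) = s / p%:R.
  by rewrite Ps expRN -/s expr2 invfM mulrA divff ?mul1r // gt_eqF.
rewrite ltr_pM2r ?invr_gt0 //.
have y2 : 0 <= y / 2 by rewrite divr_ge0.
apply: lt_le_trans (expR_ge1Dxn 6 y2).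
apply: (@le_lt_trans _ _ ((y / 2) ^+ 7 / 7`!%:R)); last by rewrite ltrDr.
rewrite ler_pdivlMr ?ltr0n ?fact_gt0 //.
have D6 : delta%:R ^+ 6 <= 64 * y ^+ 6.
  have -> : 64 * y ^+ 6 = (2 * y) ^+ 6 by ring.
  by rewrite lerXn2r // nnegrE mulr_ge0.
have y6 : 0 <= y ^+ 6 by rewrite exprn_ge0.
apply: le_trans (_ : 22 * d%:R * (64 * y ^+ 6) * 7`!%:R <= _).
  by rewrite ler_wpM2r ?ler0n // ler_wpM2l ?mulr_ge0 ?ler0n.
have -> : (y / 2) ^+ 7 = y / 128 * y ^+ 6 by field.
have -> : 22 * d%:R * (64 * y ^+ 6) * 7`!%:R = 1408 * 7`!%:R * d%:R * y ^+ 6 by ring.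
by rewrite ler_wpM2r //; clear - ylarge; lra.
Qed.

Lemma prob_uniform_ge (R : realType) (T U : finType) (w : T -> R)
    (iota : T -> U) (E : T -> Prop) (bad : {set U}) :
  injective iota -> (forall t, w t = #|T|%:R^-1) -> (0 < #|T|)%N ->
  (forall t, iota t \notin bad -> E t) ->
  1 - #|bad|%:R / #|T|%:R <= prob w E.
Proof.
move=> iota_inj wE T0 Egood; pose F := [set t | ~~ `[< E t >]].
have T0' : 0 < #|T|%:R :> R by rewrite ltr0n.
have -> : prob w E = 1 - #|F|%:R / #|T|%:R.
  apply: (canRL (addrK _)); rewrite /prob.
  under eq_bigr => t _ do rewrite wE.
  have -> : #|F|%:R / #|T|%:R = \sum_(t | ~~ `[< E t >]) #|T|%:R^-1 :> R.
    by rewrite sumr_const mulr_natl cardsE.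
  rewrite -(bigID (fun t => `[< E t >]) predT) /= sumr_const.
  by rewrite -[LHS]mulr_natr mulVf // gt_eqF.
rewrite lerB // ler_pM2r ?invr_gt0 // ler_nat.
rewrite -(card_imset _ iota_inj); apply/subset_leq_card/subsetP => u.
case/imsetP => t; rewrite inE => /asboolPn nE ->.
by apply: contrapT => /negP/Egood.
Qed.

(** Case (a) takes [inl] and [inr] for [al] and [be], case (b) the identity twice. *)
Lemma recovery_probability (R : realType) (I T : finType) (p delta m d : nat)
    (al be : 'I_p -> I) (iota : T -> {ffun I * 'I_delta -> 'I_m})
    (w : T -> R) (X N : 'M[R]_p) (E : T -> Prop) :
  injective al -> injective be -> injective iota ->
  (forall t, w t = #|T|%:R^-1) -> #|T| = (m ^ (#|I| * delta))%N -> (0 < m)%N ->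
  (0 < d)%N -> (576 * 100 * d <= delta)%N -> distributed_sparse d X ->
  (forall t, (forall Xs,
      l1_optimal (column_matrix R (iota t) al) (column_matrix R (iota t) be)
        (X + N) Xs -> l1norm (Xs - X) <= 7 * l1norm N) -> E t) ->
  1 - failure_bound R #|I| delta m d <= prob w E.
Proof.
move=> al_inj be_inj iota_inj wE cardT m0 d0 dd [Om Od suppX] Egood.
pose Om' := [set (al x.1, be x.2) | x in Om].
have rows := card_image_row al_inj be_inj Od.
have cols := card_image_col al_inj be_inj Od.
(* The colouring depends on the support alone, so it is fixed before the graph is drawn. *)
have [col [colK col_proper]] := exists_coloring rows cols.
pose L := hits_bound delta d.
pose bad1 := [set g : {ffun I * 'I_delta -> 'I_m} | [exists w, multi_edge g w]].
pose bad2 := [set g : {ffun I * 'I_delta -> 'I_m} |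
  [exists w : I * I, (w.1 != w.2) && crowded g w.1 w.2]].
pose bad3 := [set g : {ffun I * 'I_delta -> 'I_m} |
  [exists w : I * I, exists c : 'I_(4 * d), class_hit Om' col L g w.1 w.2 c]].
have T0 : (0 < #|T|)%N by rewrite cardT expn_gt0 m0.
have good t : iota t \notin bad1 :|: bad2 :|: bad3 -> E t.
  rewrite !inE !negb_or !negb_exists =>
    /andP[/andP[/forallP b1 /forallP b2] /forallP b3].
  apply: Egood => Xs.
  apply: (good_recovery al_inj be_inj (K := 4 * d) (L := L) Od suppX) => //.
  - by apply: leq_trans dd; lia.
  - exact: hits_bound_le.
  - exact: colK.
  - by move=> u v uv; have := b2 (u, v); rewrite /= uv.
  - move=> u v c cK; have := b3 (u, v); rewrite negb_exists => /forallP.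
    by move/(_ (Ordinal cK)).
apply: le_trans (prob_uniform_ge iota_inj wE T0 good).
rewrite lerB // ler_pdivrMr ?ltr0n //.
have cardI : #|{: I * 'I_delta}| = (#|I| * delta)%N by rewrite card_prod card_ord.
have le1 : #|bad1|%:R * m%:R ^+ 4 <= #|I|%:R * delta%:R ^+ 5 * #|T|%:R :> R.
  rewrite -!natrX -!natrM ler_nat; apply: leq_trans (card_multi_edge _ _ _) _.
  by rewrite cardI cardT mulnA.
have le2 : #|bad2|%:R * m%:R ^+ 6 <= #|I|%:R ^+ 2 * delta%:R ^+ 12 * #|T|%:R :> R.
  rewrite -!natrX -!natrM ler_nat; apply: leq_trans (card_crowded _ _ _) _.
  by rewrite cardI card_prod cardT -mulnn !mulnA.
have le3 : #|bad3|%:R * m%:R ^+ (2 * L) <= #|I|%:R ^+ 2 * (4 * d)%:R *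
    ('C(#|I|, L)%:R * delta%:R ^+ (4 * L)) * #|T|%:R :> R.
  rewrite -!natrX -!natrM ler_nat.
  apply: leq_trans (card_class_hit delta m (4 * d) L col_proper) _.
  by rewrite cardI card_prod cardT -mulnn !mulnA.
have Mk k : 0 < m%:R ^+ k :> R by rewrite exprn_gt0 // ltr0n.
apply: (@le_trans _ _ (#|bad1|%:R + #|bad2|%:R + #|bad3|%:R)).
  rewrite -!natrD ler_nat; apply: leq_trans (leq_card_setU _ _) _.
  by rewrite leq_add2r leq_card_setU.
rewrite /failure_bound -/L !mulrDl; apply: lerD; first apply: lerD.
- by rewrite mulrAC ler_pdivlMr.
- by rewrite mulrAC ler_pdivlMr.
- by rewrite mulrA mulrAC ler_pdivlMr.
Qed.

(** * The two random models as uniform laws on graphs *)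

Lemma ensemble_law_uniform (R : realType) (p delta m : nat)
    (g : bigraph p delta m) :
  ensemble_law R g = #|bigraph p delta m|%:R^-1.
Proof.
rewrite /ensemble_law /uniform_law card_ffun card_ffun !card_ord.
under eq_bigr => i _ do rewrite prodr_const card_ord.
by rewrite prodr_const card_ord !natrX !exprVn.
Qed.

Lemma card_bigraph (p delta m : nat) :
  #|bigraph p delta m| = (m ^ (p * delta))%N.
Proof. by rewrite card_ffun card_ffun !card_ord -expnM mulnC. Qed.

Definition uncurry_graph (p delta m : nat) (g : bigraph p delta m) :
  {ffun 'I_p * 'I_delta -> 'I_m} := [ffun x => g x.1 x.2].

Definition join_graphs (p delta m : nat)
    (g : bigraph p delta m * bigraph p delta m) :
  {ffun ('I_p + 'I_p) * 'I_delta -> 'I_m} :=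
  [ffun x => match x.1 with inl i => g.1 i x.2 | inr i => g.2 i x.2 end].

Lemma uncurry_graph_inj (p delta m : nat) :
  injective (@uncurry_graph p delta m).
Proof.
move=> g h /ffunP gh; apply/ffunP => i; apply/ffunP => k.
by have := gh (i, k); rewrite !ffunE.
Qed.

Lemma join_graphs_inj (p delta m : nat) : injective (@join_graphs p delta m).
Proof.
move=> [g1 g2] [h1 h2] /ffunP gh; congr (_, _).
  apply/ffunP => i; apply/ffunP => k.
  by have := gh (inl i, k); rewrite !ffunE.
apply/ffunP => i; apply/ffunP => k.
by have := gh (inr i, k); rewrite !ffunE.
Qed.

Lemma biadjacency_uncurry (R : realType) (p delta m : nat)
    (g : bigraph p delta m) :
  biadjacency R g = column_matrix R (uncurry_graph g) id.
Proof.
apply/matrixP => r i; rewrite !mxE /edges; congr _%:R; apply: eq_card => k.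
by rewrite !inE ffunE.
Qed.

Lemma biadjacency_join (R : realType) (p delta m : nat)
    (g : bigraph p delta m * bigraph p delta m) :
  biadjacency R g.1 = column_matrix R (join_graphs g) inl /\
  biadjacency R g.2 = column_matrix R (join_graphs g) inr.
Proof.
by split; apply/matrixP => r i; rewrite !mxE /edges; congr _%:R;
  apply: eq_card => k; rewrite !inE ffunE.
Qed.

Lemma absz_ceil_itv (R : realType) (x : R) : 0 <= x ->
  x <= `|Num.ceil x|%N%:R <= x + 1.
Proof.
move=> x0; have c0 : (0 <= Num.ceil x)%R by rewrite ceil_ge0; lra.
rewrite natr_absz ger0_norm //; have /andP[lo ->] := ceil_itv x.
by move: lo; rewrite intrD /=; lra.
Qed.

(** * Choice of constants and conclusion *)

Theorem corollary1 (R : realType) :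
  exists C1 C2 c eps : R,
    [/\ 0 < C1, 0 < C2, 0 < c & 0 < eps < 1 / 4] /\
    forall d : nat, (1 <= d)%N ->
    exists p0 : nat, forall p : nat, (p0 <= p)%N ->
    let delta := `|Num.ceil (C1 * ln p%:R)|%N in
    let m := `|Num.ceil (C2 * Num.sqrt (d * p)%:R * ln p%:R)|%N in
    forall X N : 'M[R]_p, distributed_sparse d X ->
    let success (A B : 'M[R]_(m, p)) : Prop :=
      forall Xs : 'M[R]_p, l1_optimal A B (X + N) Xs ->
        l1norm (Xs - X) <= (5 - 12 * eps) / (1 - 4 * eps) * l1norm N in
    prob (prod_law (@ensemble_law R p delta m) (@ensemble_law R p delta m))
         (fun g => success (biadjacency R g.1) (biadjacency R g.2))
      > 1 - p%:R `^ (- c) /\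
    prob (@ensemble_law R p delta m)
         (fun g => success (biadjacency R g) (biadjacency R g))
      > 1 - p%:R `^ (- c).
Proof.
(* The value [1 / 8] gives the constant 7. The square of [400 * expR 1] is four times
   [40 * 1000 * expR 2], the 4 absorbing [delta <= 2 * y]. *)
exists 1, (400 * expR 1), (1 / 2), (1 / 8); split.
  by split; rewrite ?mulr_gt0 ?expR_gt0 //; lra.
move=> d d0; pose D : R := 1408 * 128 * 7`!%:R * d%:R.
(* This makes [ln p] at least [D], the threshold of [failure_bound_lt]. *)
exists `|Num.ceil (expR D)|%N => p pD delta m X N spX success.
have D1 : 1 <= D.
  have f1 : 1 <= 7`!%:R :> R by rewrite ler1n fact_gt0.
  have d1 : 1 <= d%:R :> R by rewrite ler1n.
  by rewrite /D; nra.
have Dp : expR D <= p%:R.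
  have /andP[h _] := absz_ceil_itv (expR_ge0 D).
  by apply: le_trans h _; rewrite ler_nat.
have p0 : 0 < p%:R :> R by apply: lt_le_trans Dp; apply: expR_gt0.
pose y : R := ln p%:R.
have pE : p%:R = expR y by rewrite lnK.
have Dy : D <= y by rewrite -ler_expR -pE.
have y1 : 1 <= y := le_trans D1 Dy.
have deltay : y <= delta%:R <= 2 * y.
  have : 0 <= 1 * ln p%:R :> R by rewrite mul1r -/y; lra.
  by move/absz_ceil_itv; rewrite -/delta mul1r -/y => /andP[-> h] /=; lra.
have dd : (576 * 100 * d <= delta)%N.
  rewrite -(ler_nat R) !natrM; move: Dy deltay => Dy /andP[+ _].
  apply: le_trans; apply: le_trans Dy.
  have f1 : 1 <= 7`!%:R :> R by rewrite ler1n fact_gt0.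
  have d1 : 1 <= d%:R :> R by rewrite ler1n.
  by rewrite /D; nra.
have mlarge : 40 * 1000 * expR 2 * d%:R * p%:R * delta%:R ^+ 2 <= m%:R ^+ 2 :> R.
  have e1 : 0 < expR 1 :> R := expR_gt0 1.
  set t : R := 400 * expR 1 * Num.sqrt (d * p)%:R * y.
  have t0 : 0 <= t by rewrite !mulr_ge0 ?sqrtr_ge0 //; lra.
  have /andP[tm _] := absz_ceil_itv t0.
  apply: (@le_trans _ _ (t ^+ 2)); last by rewrite lerXn2r ?nnegrE.
  have e2 : expR 2 = expR 1 ^+ 2 :> R by rewrite -expRM_natl mulr1.
  have -> : t ^+ 2 = 160 * 1000 * expR 2 * (Num.sqrt (d * p)%:R ^+ 2) * y ^+ 2.
    by rewrite e2 /t; ring.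
  rewrite sqr_sqrtr // natrM.
  have -> : 160 * 1000 * expR 2 * (d%:R * p%:R) * y ^+ 2 =
    40 * 1000 * expR 2 * d%:R * p%:R * (2 * y) ^+ 2 :> R by ring.
  case/andP: deltay => _ h; rewrite ler_wpM2l ?mulr_ge0 ?expR_ge0 //.
  by rewrite lerXn2r // nnegrE ?ler0n //; lra.
have m0 : (0 < m)%N.
  rewrite lt0n; apply: contraTneq mlarge => ->; rewrite -ltNge expr0n /=.
  have dl : 0 < delta%:R :> R by lra.
  have dp : 0 < d%:R :> R by rewrite ltr0n.
  by rewrite !mulr_gt0 ?expR_gt0 ?exprn_gt0.
have powE : p%:R `^ (- (1 / 2)) = expR (- (y / 2)) :> R.
  by rewrite /powR gt_eqF // -/y; congr expR; lra.
have c7 : (5 - 12 * (1 / 8)) / (1 - 4 * (1 / 8)) = 7 :> R by field.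
have fail q : (q <= 2 * p)%N -> 1 - p%:R `^ (- (1 / 2)) <
    1 - failure_bound R q delta m d.
  by move=> qp; rewrite ltrD2l ltrN2 powE; apply: failure_bound_lt qp.
split; [apply: lt_le_trans (fail #|{: 'I_p + 'I_p}| _) _ |
        apply: lt_le_trans (fail #|'I_p| _) _].
- by rewrite card_sum card_ord; lia.
- apply: (@recovery_probability R _ _ p delta m d inl inr (@join_graphs p delta m)
    _ X N) => //.
  + by move=> i j [].
  + by move=> i j [].
  + exact: join_graphs_inj.
  + move=> g; rewrite /prod_law !ensemble_law_uniform card_prod natrM invfM //.
  + by rewrite card_prod card_bigraph card_sum card_ord -expnD -mulnDl.
  + move=> g good Xs; rewrite c7 (biadjacency_join R g).1 (biadjacency_join R g).2.
    exact: good.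
- by rewrite card_ord; lia.
- apply: (@recovery_probability R _ _ p delta m d id id (@uncurry_graph p delta m)
    _ X N) => //.
  + exact: uncurry_graph_inj.
  + by move=> g; rewrite ensemble_law_uniform.
  + by rewrite card_bigraph card_ord.
  + by move=> g good Xs; rewrite c7 !biadjacency_uncurry; exact: good.
Qed.
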